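(* Let $(U,H)$ be an APK-compatible pair and let $\mathfrak g_U$ be the associated pseudo-Kähler Lie algebra with abelian complex structure, with pseudo-Kähler metric $g$. The Levi-Civita connection, the Riemannian curvature tensor and the Ricci curvature of $g$ are given, for $x,y\in U$, by $$\nabla_xy=(R_x-R_x^* )y,\qquad \mathbf R(x,y)=3R_xR_y^*-3R_yR_x^*+R_x^*R_y-R_y^*R_x,\qquad \mathrm{Ric}(x,y)=-2\,\mathrm{trace}(R_yR_x^* ),$$ where the trace is the trace of the underlying $\mathbb R$-linear map.
   Context: All algebras are finite dimensional. Hermitian forms are $\mathbb C$-linear in the first argument, conjugate-linear in the second, and not assumed definite. Let $U$ be a complex associative commutative algebra (not necessarily unital) with a non-degenerate hermitian form $H$; $R_z$ denotes multiplication by $z$ in $U$ and $R_z^*$ its $H$-adjoint, $H(R_z^*x,y)=H(x,R_zy)$. The pair $(U,H)$ is APK-compatible if $xR_z^*y=yR_z^*x$ for all $x,y,z\in U$. Then $\mathfrak g_U$ is the underlying real vector space of $U$ with bracket $[x,y]=R_y^*x-R_x^*y$, complex structure $Jx=ix$ and symplectic form $\omega(x,y)=\mathrm{Im}\,H(x,y)$. The pseudo-Kähler metric is $g(x,y)=\omega(Jx,y)=\mathrm{Re}\,H(x,y)$. The Levi-Civita connection is determined by $2g(\nabla_xy,z)=g([x,y],z)-g([y,z],x)+g([z,x],y)$; the curvature convention is $\mathbf R(x,y)=\nabla_{[x,y]}-\nabla_x\nabla_y+\nabla_y\nabla_x$; and $\mathrm{Ric}(x,y)=\mathrm{trace}(z\mapsto\mathbf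 R(x,z)y)$ (trace over $\mathbb R$). *)

(* Defs.v *)
From HB Require Import structures.
From mathcomp Require Import all_boot all_order all_algebra.
From mathcomp Require Import complex.
From mathcomp Require Import boolp classical_sets reals.
From mathcomp Require Import ring.

Set Implicit Arguments.
Unset Strict Implicit.
Unset Printing Implicit Defensive.

Import Order.TTheory GRing.Theory Num.Theory.

Local Open Scope ring_scope.
Local Open Scope complex_scope.

Section Trace.
Variables (K : fieldType) (V : vectType K).

Definition lftrace (f : 'End(V)) : K :=
  \tr (passmx.mxof (vbasis fullv) (vbasis fullv) f).

Lemma lftrace_basis (e : (\dim {:V}).-tuple V) (f : 'End(V)) :
  basis_of {:V} e -> lftrace f = \sum_i coord e i (f e`_i).
Proof.
move=> eb; have vb := vbasisP {:V}.
transitivity (\tr (passmx.mxof e e f)); last first.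
  by apply: eq_bigr => i _; rewrite mxE /= passmx.vecof_delta mxE.
have fE : f = (\1 \o (f \o \1))%VF by rewrite comp_lfun1r comp_lfun1l.
rewrite /lftrace [in RHS]fE !(passmx.mxof_comp _ _ vb).
rewrite mxtrace_mulC mulmxA -(passmx.mxof_comp _ _ eb) comp_lfun1l.
by rewrite passmx.mxof1 ?(basis_free vb)// mul1mx.
Qed.

End Trace.

(* A complex vector space regarded as a real one. *)
Definition realification (R : realType) (U : vectType R[i]) : Type := U.

Section Realification.
Variables (R : realType) (U : vectType R[i]).
Local Notation UR := (realification U).

HB.instance Definition _ := GRing.Zmodule.on UR.

Definition real_scale (a : R) (v : UR) : UR := a%:C *: (v : U).

Fact real_scaleA a b v :
  real_scale a (real_scale b v) = real_scale (a * b) v.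
Proof. by rewrite /real_scale scalerA -rmorphM. Qed.

Fact real_scale1 : left_id 1 real_scale.
Proof. by move=> v; rewrite /real_scale rmorph1 scale1r. Qed.

Fact real_scaleDr : right_distributive real_scale +%R.
Proof. by move=> a u v; rewrite /real_scale scalerDr. Qed.

Fact real_scaleDl v : {morph real_scale^~ v : a b / a + b}.
Proof. by move=> a b; rewrite /real_scale rmorphD scalerDl. Qed.

HB.instance Definition _ := GRing.Zmodule_isLmodule.Build R UR
  real_scaleA real_scale1 real_scaleDr real_scaleDl.

Lemma real_scaleE (a : R) (v : U) : a *: (v : UR) = a%:C *: v.
Proof. by []. Qed.

Fact realification_axiom : Lmodule_hasFinDim R UR.
Proof.
pose d := \dim {:U}; pose b := vbasis {:U}.
pose f (x : UR) : 'rV[R]_(d + d) :=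
  row_mx (map_mx (@complex.Re R) (passmx.rVof b (x : U))) (map_mx (@complex.Im R) (passmx.rVof b (x : U))).
pose g (r : 'rV[R]_(d + d)) : UR :=
  passmx.vecof b (\row_j (lsubmx r 0 j +i* rsubmx r 0 j)) : U.
have bb : basis_of {:U} b := vbasisP _.
have fl : linear f.
  move=> a x y; rewrite /f scale_row_mx add_row_mx.
  have -> : passmx.rVof b (a *: x + y : UR) =
      a%:C *: passmx.rVof b (x : U) + passmx.rVof b (y : U).
    exact: passmx.rVof_linear.
  congr row_mx; apply/rowP=> j; rewrite !mxE.
  - by case: (coord _ _ _) (coord _ _ _) => [p q] [r s] /=; rewrite mul0r subr0.
  - by case: (coord _ _ _) (coord _ _ _) => [p q] [r s] /=; rewrite mul0r addr0.
exists (d + d)%N, f => //; exists g => [x|r]; rewrite /f /g.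
- apply: (canLR (passmx.rVofK bb)); apply/rowP=> j.
  rewrite mxE row_mxKl row_mxKr !mxE.
  by case: (coord _ _ _).
- rewrite (passmx.vecofK bb) -[RHS]hsubmxK; congr row_mx; apply/rowP=> j; by rewrite !mxE.
Qed.

HB.instance Definition _ := realification_axiom.

End Realification.

Section Representation.
Variables (K : fieldType) (eps : bool) (theta : {rmorphism K -> K}).
Variables (V : vectType K) (h : {hermitian V for eps & theta}).

Lemma nondegenerate_inj (u v : V) :
  nondegenerate h -> (forall w, h u w = h v w) -> u = v.
Proof.
move=> nd uv; apply/eqP; rewrite -subr_eq0 -memv0 -(eqP nd).
by apply/mem_orthovP => w _; rewrite linearBl /= uv subrr.
Qed.

(* The Gram map w |-> (h w e_j)_j, bijective when h is nondegenerate. *)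
Let gram (w : V) : 'rV[K]_(\dim {:V}) := \row_j h w (vbasis {:V})`_j.

Lemma nondegenerate_repr : nondegenerate h ->
  exists G : {linear 'rV[K]_(\dim {:V}) -> V},
    forall r (j : 'I_(\dim {:V})), h (G r) (vbasis {:V})`_j = r 0 j.
Proof.
move=> nd.
have gl : linear gram.
  by move=> a x y; apply/rowP=> j; rewrite !mxE linearDl linearZl_LR.
pose gL : {linear V -> 'rV[K]_(\dim {:V})} := HB.pack gram
  (GRing.isLinear.Build _ _ _ _ gram gl).
pose gf := linfun gL.
have k0 : lker gf == 0%VS.
  apply/lker0P => x y; rewrite !lfunE /= => e; apply: nondegenerate_inj nd _ => w.
  rewrite [w](coord_vbasis (memvf _)) !linear_sumr; apply: eq_bigr => j _.
  rewrite !linearZr_LR /=; congr (_ * _).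
  by move/rowP/(_ j): e; rewrite !mxE.
have full : limg gf = fullv.
  apply/eqP; rewrite eqEdim subvf /= limg_dim_eq ?(eqP k0) ?capv0 //.
  by rewrite !dimvf /dim /= mul1n.
exists (gf^-1)%VF => r j.
have /rowP/(_ j) : gf ((gf^-1)%VF r) = r by apply: limg_lfunVK; rewrite full memvf.
by rewrite lfunE /= mxE.
Qed.

End Representation.

Section Adjoint.
Variables (R : realType) (U : vectType R[i]).
Variable H : {hermitian U for false & @conjc R}.

(* The H-adjoint of f, characterised by adjointP; it is unique, and it exists
   as soon as H is nondegenerate. *)
Definition adjoint (f : 'End(U)) : 'End(U) :=
  xget 0 [set g : 'End(U) | forall x y, H (g x) y = H x (f y)]%classic.

Lemma adjointP (f : 'End(U)) : nondegenerate H ->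
  forall x y, H (adjoint f x) y = H x (f y).
Proof.
move=> nd; have [G GP] := nondegenerate_repr nd.
pose a (x : U) : 'rV[R[i]]_(\dim {:U}) := \row_j H x (f (vbasis {:U})`_j).
have al : linear a.
  by move=> c x y; apply/rowP=> j; rewrite !mxE linearDl linearZl_LR.
pose aL : {linear U -> 'rV[R[i]]_(\dim {:U})} := HB.pack a
  (GRing.isLinear.Build _ _ _ _ a al).
suff : exists g : 'End(U), forall x y, H (g x) y = H x (f y).
  by rewrite /adjoint => /xgetPex; apply.
exists (linfun (G \o aL)) => x y; rewrite lfunE /=.
have fy : f y = \sum_j coord (vbasis fullv) j y *: f (vbasis {:U})`_j.
  rewrite {1}[y](coord_vbasis (memvf _)) linear_sum.
  by apply: eq_bigr => j _; rewrite linearZ.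
rewrite fy [y in LHS](coord_vbasis (memvf _)) !linear_sumr.
apply: eq_bigr => j _; rewrite !linearZr_LR /=; congr (_ * _).
by rewrite GP mxE.
Qed.

Lemma adjoint_unique (f g : 'End(U)) : nondegenerate H ->
  (forall x y, H (g x) y = H x (f y)) -> adjoint f = g.
Proof.
move=> nd gP; apply/lfunP => x; apply: (nondegenerate_inj nd) => y.
by rewrite adjointP// gP.
Qed.

End Adjoint.

(* Left-invariant pseudo-Riemannian geometry of a real Lie algebra V with
   bracket br and metric g. *)
Section LeftInvariantGeometry.
Variables (R : realType) (V : vectType R).
Variables (br : V -> V -> V) (g : V -> V -> R).

(* Defined by the Koszul formula; see levi_civitaP. *)
Definition levi_civita (x y : V) : V :=
  xget 0 [set w : V | forall z,
    2 * g w z = g (br x y) z - g (br y z) x + g (br z x) y]%classic.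

(* R(x,y) = nabla_[x,y] - [nabla_x, nabla_y], opposite to the usual sign. *)
Definition curvature (x y z : V) : V :=
  levi_civita (br x y) z - levi_civita x (levi_civita y z)
  + levi_civita y (levi_civita x z).

Definition ricci (x y : V) : R := lftrace (linfun (fun z => curvature x z y)).

End LeftInvariantGeometry.

Lemma levi_civitaP (R : realType) (V : vectType R)
    (br : V -> V -> V) (g : {symmetric V}) (x y z : V) :
  nondegenerate g -> linear (br y) -> linear (br^~ x) ->
  2 * g (levi_civita br g x y) z = g (br x y) z - g (br y z) x + g (br z x) y.
Proof.
move=> nd bry brx; have [G GP] := nondegenerate_repr nd; move: z.
pose k z := g (br x y) z - g (br y z) x + g (br z x) y.
suff : exists w, forall z, 2 * g w z = k z.
  by rewrite /levi_civita => /xgetPex; apply.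
have kl : scalar k.
  move=> a u v; rewrite /k.
  have -> : g (br x y) (a *: u + v) = a * g (br x y) u + g (br x y) v.
    by rewrite linearDr linearZr_LR.
  rewrite bry brx !linearDl !linearZl_LR /=; ring.
exists (2^-1 *: G (\row_j k (vbasis {:V})`_j)) => z.
rewrite linearZl_LR mulrA divff ?pnatr_eq0// mul1r.
pose kL : {scalar V} := HB.pack k (GRing.isLinear.Build _ _ _ _ k kl).
have -> : k z = kL z by [].
rewrite [z](coord_vbasis (memvf _)) linear_sumr [RHS]linear_sum.
apply: eq_bigr => j _; rewrite linearZr_LR [RHS]linearZ /=; congr (_ * _).
by rewrite GP mxE.
Qed.

Section APK.
Variables (R : realType) (U : vectType R[i]).
Variables (mul : {bilinear U -> U -> U}) (H : {hermitian U for false & @conjc R}).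

Definition rmul (z : U) : 'End(U) := linfun (mul^~ z).
Definition rmul_adj (z : U) : 'End(U) := adjoint H (rmul z).

Definition apk_compatible : Prop :=
  forall x y z, mul x (rmul_adj z y) = mul y (rmul_adj z x).

Local Notation gU := (realification U).

(* The Lie algebra g_U is the real vector space gU with this bracket. *)
Definition apk_bracket (x y : gU) : gU := rmul_adj y x - rmul_adj x y.
Definition apk_J (x : gU) : gU := 'i *: (x : U).
Definition apk_omega (x y : gU) : R := complex.Im (H x y).
Definition apk_metric (x y : gU) : R := apk_omega (apk_J x) y.

Lemma apk_metricE x y : apk_metric x y = complex.Re (H x y).
Proof.
rewrite /apk_metric /apk_omega /apk_J linearZl_LR /=.
by case: (H x y) => a b /=; rewrite mul0r mul1r add0r.
Qed.

Fact apk_metric_bilinear : bilinear_for *%R (idfun \; *%R) apk_metric.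
Proof.
split=> z a x y; rewrite !apk_metricE !real_scaleE.
- rewrite linearDl linearZl_LR /=.
  by case: (H x z) (H y z) => [p q] [r s] /=; rewrite mul0r subr0.
- rewrite linearDr linearZr_LR /=.
  by case: (H z x) (H z y) => [p q] [r s] /=; rewrite oppr0 mul0r subr0.
Qed.

HB.instance Definition _ := bilinear_isBilinear.Build R gU gU R *%R (idfun \; *%R)
  apk_metric apk_metric_bilinear.

Fact apk_metric_sym x y : apk_metric x y = (-1) ^+ false * apk_metric y x.
Proof.
rewrite !apk_metricE expr0 mul1r [H x y]hermitian_subproof expr0 mul1r.
by case: (H y x).
Qed.

HB.instance Definition _ := isHermitianSesquilinear.Build R gU false idfun
  apk_metric apk_metric_sym.

Lemma apk_metric_nondegenerate : nondegenerate H -> nondegenerate (apk_metric : {symmetric gU}).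
Proof.
move=> nd; rewrite /nondegenerate -subv0; apply/subvP => u.
move/mem_orthovP => u0; rewrite memv0; apply/eqP.
apply: (nondegenerate_inj nd) => w; rewrite linear0l.
have := u0 (apk_J w) (memvf _); have := u0 (w : gU) (memvf _).
rewrite /= !apk_metricE /apk_J linearZr_LR /=.
by case: (H u w) => a b /= ->; rewrite mul0r sub0r mulN1r opprK => ->.
Qed.

Lemma apk_bracketC x y : apk_bracket x y = - apk_bracket y x.
Proof. by rewrite /apk_bracket opprB. Qed.

Lemma rmul_adj_conj_linear (a : R[i]) (u v x : U) : nondegenerate H ->
  rmul_adj (a *: u + v) x = conjc a *: rmul_adj u x + rmul_adj v x.
Proof.
have lE z (y : U) : rmul z y = mul y z.
  have ml : linear (mul^~ z) by move=> c s t; rewrite linearDl linearZl_LR.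
  pose mL : {linear U -> U} := HB.pack (mul^~ z)
    (GRing.isLinear.Build _ _ _ _ (mul^~ z) ml).
  exact: (lfunE mL y).
move=> nd; apply: (nondegenerate_inj nd) => y.
rewrite linearDl linearZl_LR /= !adjointP// !lE linearDr linearZr_LR.
by rewrite linearDr linearZr_LR.
Qed.

Lemma apk_bracket_linearr x : nondegenerate H -> linear (apk_bracket x).
Proof.
move=> nd a u v; rewrite /apk_bracket !real_scaleE rmul_adj_conj_linear//.
rewrite conjc_real linearD linearZ /= scalerBr.
by rewrite opprD addrACA.
Qed.

Lemma apk_bracket_linearl y : nondegenerate H -> linear (apk_bracket^~ y).
Proof.
move=> nd a u v; rewrite /= apk_bracketC apk_bracket_linearr//.
by rewrite opprD -scalerN -!apk_bracketC.
Qed.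

Definition apk_nabla : gU -> gU -> gU := levi_civita apk_bracket apk_metric.
Definition apk_curvature : gU -> gU -> gU -> gU :=
  curvature apk_bracket apk_metric.
Definition apk_ricci : gU -> gU -> R := ricci apk_bracket apk_metric.

Lemma apk_nablaP x y z : nondegenerate H ->
  2 * apk_metric (apk_nabla x y) z =
  apk_metric (apk_bracket x y) z - apk_metric (apk_bracket y z) x
  + apk_metric (apk_bracket z x) y.
Proof.
move=> nd; apply: levi_civitaP.
- exact: apk_metric_nondegenerate.
- exact: apk_bracket_linearr.
- exact: apk_bracket_linearl.
Qed.

End APK.

(* The trace over R of a C-linear map. *)
Definition real_trace (R : realType) (U : vectType R[i]) (f : 'End(U)) : R :=
  lftrace (linfun (f : realification U -> realification U)).

(* Main.v *)
(* Writing R and R^* for the multiplications and their adjoints, APK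
   compatibility says R_y R_z^* = R_(R_z^* y), and its adjoint form is
   R_z R_y^* = R^*_(R_z^* y); together with the commutativity of the R's and of
   the R^*'s these give the curvature.  In the Ricci trace the terms in which
   z occurs as R_z^* are conjugate-linear in z, so they anticommute with the
   complex structure and have real trace zero; the other ones are turned into
   R_y R_x^* z and R_x^* R_y z by commutativity and compatibility. *)
From HB Require Import structures.
Require Import Defs.
From mathcomp Require Import all_boot all_order all_algebra.
From mathcomp Require Import complex reals.
From mathcomp Require Import boolp ring.

Set Implicit Arguments.
Unset Strict Implicit.
Unset Printing Implicit Defensive.

Import GRing.Theory Num.Theory.

Local Open Scope ring_scope.
Local Open Scope complex_scope.

(** [linfun] accepts any bare function, but [lfunE] evaluates it only on a bundled linear map; the
    bundle is built here from a proof of linearity. *)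
Lemma linfunE (K : fieldType) (V W : vectType K) (f : V -> W) :
  linear f -> linfun f =1 f.
Proof.
move=> fl x; pose F : {linear V -> W} := HB.pack f
  (GRing.isLinear.Build _ _ _ _ f fl).
exact: (lfunE F x).
Qed.

Section Trace.
Context {K : fieldType} {V : vectType K}.
Implicit Types f g : 'End(V).

Lemma lftrace_linear : scalar (@lftrace K V).
Proof.
move=> a f g; rewrite !(lftrace_basis _ (vbasisP fullv)) mulr_sumr -big_split.
by apply: eq_bigr => i _; rewrite /= add_lfunE scale_lfunE linearP.
Qed.

Lemma lftraceD f g : lftrace (f + g) = lftrace f + lftrace g.
Proof. by rewrite -[f]scale1r lftrace_linear mul1r scale1r. Qed.

Lemma lftrace0 : lftrace (0 : 'End(V)) = 0.
Proof. by have /esym/eqP := lftraceD 0 0; rewrite addr0 -subr_eq0 addrK => /eqP. Qed.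

Lemma lftraceZ a f : lftrace (a *: f) = a * lftrace f.
Proof. by rewrite -[_ *: _]addr0 lftrace_linear lftrace0 addr0. Qed.

Lemma lftrace_compC f g : lftrace (f \o g)%VF = lftrace (g \o f)%VF.
Proof.
have vb := vbasisP {:V}.
by rewrite /lftrace !(passmx.mxof_comp _ _ vb) mxtrace_mulC.
Qed.

End Trace.

Section Realification.
Context {R : realType} {U : vectType R[i]}.
Local Notation UR := (realification U).

Definition conj_linear (f : U -> U) : Prop :=
  forall a u v, f (a *: u + v) = conjc a *: f u + f v.

Lemma real_linear_of_linear (f : 'End(U)) : linear (f : UR -> UR).
Proof. by move=> a u v; rewrite !real_scaleE linearP. Qed.

Definition realify (f : 'End(U)) : 'End(UR) := linfun (f : UR -> UR).

Lemma realifyE (f : 'End(U)) (u : U) : realify f u = f u.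
Proof. exact: (linfunE (real_linear_of_linear f)). Qed.

Lemma real_traceE (f : 'End(U)) : real_trace f = lftrace (realify f).
Proof. by []. Qed.

Lemma real_linear_of_conj_linear (f : U -> U) :
  conj_linear f -> linear (f : UR -> UR).
Proof. by move=> fl a u v; rewrite !real_scaleE fl conjc_real. Qed.

(** Restriction of scalars respects composition, so cyclicity is inherited from [lftrace]. *)
Lemma real_traceC (f g : 'End(U)) :
  real_trace (f \o g)%VF = real_trace (g \o f)%VF.
Proof.
have compE (p q : 'End(U)) : realify (p \o q)%VF = (realify p \o realify q)%VF.
  by apply/lfunP => u; rewrite comp_lfunE !realifyE comp_lfunE.
by rewrite !real_traceE !compE lftrace_compC.
Qed.

(* With J the complex structure, J f J = f whereas tr (J f J) = tr (f J J). *)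
Lemma lftrace_conj_linear (f : U -> U) :
  conj_linear f -> lftrace (linfun (f : UR -> UR)) = 0.
Proof.
move=> fl; set F := linfun _.
have FE u : F u = f u by exact: (linfunE (real_linear_of_conj_linear fl)).
have iZ (c : R[i]) (u v : U) : 'i *: (c *: u + v) = c *: ('i *: u) + 'i *: v.
  by rewrite scalerDr !scalerA [_ * c]mulrC.
have Jl : linear (@apk_J R U) by move=> a u v; apply: iZ.
pose J := linfun (@apk_J R U).
have JE u : J u = 'i *: (u : U) by rewrite linfunE.
have JJ : (J \o J)%VF = - \1%VF.
  apply/lfunP => u; rewrite comp_lfunE !JE scalerA -expr2 sqr_i scaleN1r.
  by rewrite opp_lfunE id_lfunE.
have JFJ : (J \o F \o J)%VF = F.
  apply/lfunP => u; rewrite !comp_lfunE !(JE, FE).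
  have f0 : f 0 = 0.
    have /esym/eqP := fl 1 0 0.
    by rewrite scaler0 addr0 rmorph1 scale1r -subr_eq0 addrK => /eqP.
  have -> : f ('i *: (u : U)) = conjc 'i *: f u.
    by rewrite -[_ *: _]addr0 fl f0 addr0.
  rewrite scalerA.
  have -> : 'i * conjc 'i = 1 :> R[i] by simpc.
  by rewrite scale1r.
have FN : lftrace F = - lftrace F.
  rewrite -[in LHS]JFJ -comp_lfunA lftrace_compC -comp_lfunA JJ comp_lfunNr.
  by rewrite comp_lfun1r -scaleN1r lftraceZ mulN1r.
have /eqP : lftrace F *+ 2 = 0 by rewrite mulr2n {1}FN addNr.
by rewrite mulrn_eq0 => /eqP.
Qed.

End Realification.

Section APK.
Context {R : realType} {U : vectType R[i]}.
Variables (mul : {bilinear U -> U -> U}) (H : {hermitian U for false & @conjc R}).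
Hypotheses (mulA : associative mul) (mulC : commutative mul).
Hypotheses (nd : nondegenerate H) (apk : apk_compatible mul H).
Local Notation r := (rmul mul).
Local Notation rs := (rmul_adj mul H).

Lemma rmulE x y : r x y = mul y x.
Proof.
by apply: linfunE => a u v; rewrite linearDl linearZl_LR.
Qed.

Lemma rmul_swap x y : r x y = r y x.
Proof. by rewrite !rmulE mulC. Qed.

Lemma rmulC x y z : r x (r y z) = r y (r x z).
Proof. by rewrite !rmulE -!mulA [mul x y]mulC. Qed.

Lemma rmulB u v x : r (u - v) x = r u x - r v x.
Proof. by rewrite !(rmul_swap _ x) linearB. Qed.

Lemma rmul_adjP x u v : H (rs x u) v = H u (r x v).
Proof. exact: adjointP. Qed.

Lemma hermC u v : H u v = conjc (H v u).
Proof. by rewrite [LHS]hermitian_subproof expr0 mul1r. Qed.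

Lemma rmul_adjPr x u v : H u (rs x v) = H (r x u) v.
Proof. by rewrite hermC rmul_adjP -hermC. Qed.

Lemma rmul_adjC x y z : rs x (rs y z) = rs y (rs x z).
Proof.
by apply: (nondegenerate_inj nd) => w; rewrite !rmul_adjP rmulC.
Qed.

Lemma rmul_adjB u v x : rs (u - v) x = rs u x - rs v x.
Proof.
(* The difference is read as [-1 *: v + u]; conjugation fixes -1. *)
rewrite addrC -scaleN1r rmul_adj_conj_linear// rmorphN rmorph1 scaleN1r.
by rewrite addrC.
Qed.

Lemma rmul_rmul_adj y z x : r (rs z y) x = r y (rs z x).
Proof. by rewrite !rmulE apk mulC mulC. Qed.

(** Pairing with [w] and moving the outer adjoint across [H] exposes [r (rs z y) w], to which
    compatibility applies; both factors then move back. *)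
Lemma rmul_adj_rmul_adj y z x : rs (rs z y) x = r z (rs y x).
Proof.
apply: (nondegenerate_inj nd) => w.
by rewrite rmul_adjP rmul_rmul_adj -rmul_adjP rmul_adjPr.
Qed.

(** With all adjoints moved across [H] in the Koszul formula, the two terms [H x (r y z)] cancel,
    and [H (r x y) z] and [- H y (r x z)] each occur twice up to conjugation, which the real part
    ignores. *)
Lemma apk_nablaE (x y : U) : apk_nabla mul H x y = r x y - rs x y.
Proof.
have ndg := apk_metric_nondegenerate nd.
apply: (nondegenerate_inj ndg) => z; apply: (@mulfI R 2); rewrite ?pnatr_eq0//.
have gB (u v w : U) :
    apk_metric H (u - v) w = complex.Re (H u w) - complex.Re (H v w).
  by rewrite apk_metricE linearBl raddfB.
rewrite apk_nablaP// /apk_bracket !gB !rmul_adjP.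
rewrite (rmul_swap z x) (rmul_swap y x) (rmul_swap z y) (hermC z).
rewrite [RHS](congr1 ( *%R 2) (gB (r x y) (rs x y) z)) rmul_adjP.
by case: (H x _) (H y _) (H (r x y) _) => [a b] [c d] [e f] /=; ring.
Qed.

(** The bracket term yields two copies of [r x (rs y z) - r y (rs x z)]; minus the commutator of the
    [nabla]s yields the third copy and the terms with [rs] outermost. *)
Lemma apk_curvatureE (x y z : U) : apk_curvature mul H x y z =
  (3 *: r x (rs y z) - 3 *: r y (rs x z) + rs x (r y z) - rs y (r x z) : U).
Proof.
pose nabla (u v : U) : U := r u v - rs u v.
have -> : apk_curvature mul H x y z = (nabla (rs y x - rs x y) z
    - nabla x (nabla y z) + nabla y (nabla x z) : U).
  by rewrite /apk_curvature /curvature -!/(apk_nabla mul H _ _) !apk_nablaE.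
rewrite /nabla rmulB rmul_adjB !rmul_rmul_adj !rmul_adj_rmul_adj.
rewrite !linearB /= (rmulC y x) (rmul_adjC y x) !opprK.
have mul3 (v : U) : 3 *: v = v + v + v by rewrite scaler_nat !mulrSr mulr0n add0r.
rewrite !mul3 !opprD.
(* The last two pairs are the pure [r]-[r] and [rs]-[rs] products, which cancel. *)
rewrite [LHS](AC (((2*2)*(2*2))*(2*2))
  ((1*4*6)*(2*3*10)*7*11*(5*9)*(8*12)))/=.
by rewrite !addNr !addr0.
Qed.

Lemma apk_ricciE (x y : U) :
  apk_ricci mul H x y = - 2 * real_trace (r y \o rs x)%VF.
Proof.
(* The part of the curvature in which [z] enters through [rs z], hence of real trace zero. *)
pose f (z : U) : U := 3 *: r x (rs z y) - rs z (r x y).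
have fl : conj_linear f.
  move=> a u v; rewrite /f !rmul_adj_conj_linear// linearP.
  rewrite !scalerDr scalerN !scalerA [3 * _]mulrC opprD.
  by rewrite addrACA.
pose G := (-3) *: realify (r y \o rs x)%VF + (realify (rs x \o r y)%VF +
  linfun (f : realification U -> realification U)).
rewrite /apk_ricci /ricci.
have -> : (fun z => curvature (apk_bracket mul H) (apk_metric H) x z y) = G.
  apply/funext => z; rewrite -[LHS]/(apk_curvature mul H x z y).
  (* Here [r z (rs x y)] becomes [r y (rs x z)], an operator applied to [z]. *)
  rewrite apk_curvatureE (rmul_swap z (rs x y)) rmul_rmul_adj (rmul_swap z y).
  rewrite !add_lfunE scale_lfunE real_scaleE !realifyE.
  rewrite (linfunE (real_linear_of_conj_linear fl)) !comp_lfunE /f.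
  have -> : (-3)%:C = -3 :> R[i] by rewrite rmorphN rmorph_nat.
  rewrite scaleNr.
  by rewrite [LHS](AC (3*1) (2*(3*(1*4)))).
have -> : linfun G = G by apply/lfunP => z; rewrite lfunE.
(* Cyclicity identifies the two remaining traces, with coefficients -3 and 1. *)
rewrite !lftraceD lftraceZ -!real_traceE lftrace_conj_linear// real_traceC.
ring.
Qed.

End APK.

Unset Implicit Arguments.

Theorem proposition4p2 (R : realType) (U : vectType R[i])
    (mul : {bilinear U -> U -> U}) (H : {hermitian U for false & @conjc R}) :
  associative mul -> commutative mul ->
  nondegenerate H -> apk_compatible mul H ->
  let r := rmul mul in
  let rs := rmul_adj mul H in
  [/\ forall x y : U, apk_nabla mul H x y = (r x - rs x) y,
      forall x y z : U,
        apk_curvature mul H x y z =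
          (3 *: (r x \o rs y) - 3 *: (r y \o rs x)
           + (rs x \o r y) - (rs y \o r x))%VF z
    & forall x y : U,
        apk_ricci mul H x y = - 2 * real_trace (r y \o rs x)%VF].
Proof.
move=> mulA mulC nd apk r rs; split=> x y.
- by rewrite apk_nablaE// add_lfunE opp_lfunE.
- move=> z; rewrite apk_curvatureE//.
  by rewrite !(add_lfunE, opp_lfunE, scale_lfunE, comp_lfunE).
- exact: apk_ricciE.
Qed.
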